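(* Let $G$ be a $2$-connected graph of order $n$ with clique number $\omega$. Then there exists a cycle in $G$ containing all vertices of $G$ of degree at least $n-\omega$, unless $\frac{n+1}{2}\le\omega\le n-2$ and $G\cong K_{n-\omega}\vee (K_{2\omega-n}\cup \overline{K_{n-\omega}})$.
   Context: All graphs are finite, undirected, without loops or multiple edges. The clique number of $G$ is the maximum cardinality of a clique in $G$. $K_m$ denotes the complete graph on $m$ vertices and $\overline{H}$ the complement of a graph $H$ (so $\overline{K_m}$ is the edgeless graph on $m$ vertices). For graphs $G,H$, $G\cup H$ is their disjoint union and $G\vee H$ (the join) is obtained from $G\cup H$ by adding all edges between $V(G)$ and $V(H)$. *)

(* Defs.v *)
From mathcomp Require Import all_boot.

Set Implicit Arguments.
Unset Strict Implicit.
Unset Printing Implicit Defensive.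

Record sgraph := SGraph {
  vertex :> finType;
  adj : rel vertex;
  adj_sym : symmetric adj;
  adj_irrefl : irreflexive adj
}.

Definition degree (G : sgraph) (x : G) : nat := #|[set y | adj x y]|.

Definition is_clique (G : sgraph) (A : {set G}) : bool :=
  [forall x in A, forall y in A, (x != y) ==> adj x y].

Definition clique_number (G : sgraph) : nat :=
  \max_(A : {set G} | is_clique A) #|A|.

(* A cycle is given by the list of its vertices in cyclic order. The bound on
   the length is needed since [ucycle] also accepts [::] and [:: x; y]. *)
Definition is_cycle (G : sgraph) (c : seq G) : bool :=
  (3 <= size c) && ucycleb (@adj G) c.

Section Induced.
Variables (G : sgraph) (A : {set G}).
Definition induced_adj : rel {x : G | x \in A} :=
  fun x y => adj (val x) (val y).
Lemma induced_sym : symmetric induced_adj.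
Proof. by move=> x y; apply: adj_sym. Qed.
Lemma induced_irrefl : irreflexive induced_adj.
Proof. by move=> x; apply: adj_irrefl. Qed.
Definition induced : sgraph := SGraph induced_sym induced_irrefl.
End Induced.

Definition connected (G : sgraph) : Prop :=
  0 < #|G| /\ forall x y : G, connect (@adj G) x y.

Definition k_connected (k : nat) (G : sgraph) : Prop :=
  k < #|G| /\ forall X : {set G}, #|X| < k -> connected (induced (~: X)).

Section Complete.
Variable m : nat.
Definition complete_adj : rel 'I_m := fun x y => x != y.
Lemma complete_sym : symmetric complete_adj.
Proof. by move=> x y; rewrite /complete_adj eq_sym. Qed.
Lemma complete_irrefl : irreflexive complete_adj.
Proof. by move=> x; rewrite /complete_adj eqxx. Qed.
Definition complete : sgraph := SGraph complete_sym complete_irrefl.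
End Complete.

Section Complement.
Variable G : sgraph.
Definition compl_adj : rel G := fun x y => (x != y) && ~~ adj x y.
Lemma compl_sym : symmetric compl_adj.
Proof. by move=> x y; rewrite /compl_adj eq_sym adj_sym. Qed.
Lemma compl_irrefl : irreflexive compl_adj.
Proof. by move=> x; rewrite /compl_adj eqxx. Qed.
Definition compl : sgraph := SGraph compl_sym compl_irrefl.
End Complement.

Section UnionJoin.
Variables G H : sgraph.

Definition union_adj : rel (G + H) := fun u v =>
  match u, v with
  | inl x, inl y => adj x y
  | inr x, inr y => adj x y
  | _, _ => false
  end.
Lemma union_sym : symmetric union_adj.
Proof. by move=> [x|x] [y|y] //=; apply: adj_sym. Qed.
Lemma union_irrefl : irreflexive union_adj.
Proof. by move=> [x|x] /=; apply: adj_irrefl. Qed.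
Definition union : sgraph := SGraph union_sym union_irrefl.

Definition join_adj : rel (G + H) := fun u v =>
  match u, v with
  | inl x, inl y => adj x y
  | inr x, inr y => adj x y
  | _, _ => true
  end.
Lemma join_sym : symmetric join_adj.
Proof. by move=> [x|x] [y|y] //=; apply: adj_sym. Qed.
Lemma join_irrefl : irreflexive join_adj.
Proof. by move=> [x|x] /=; apply: adj_irrefl. Qed.
Definition join : sgraph := SGraph join_sym join_irrefl.
End UnionJoin.

Definition isomorphic (G H : sgraph) : Prop :=
  exists2 f : G -> H, bijective f & forall x y, adj (f x) (f y) = adj x y.

(* Main.v *)
Require Import Defs.
From mathcomp Require Import all_boot.
From mathcomp Require Import zify.

(* If x and y are nonadjacent and their degrees add up to at least the order of
   the graph, adding the edge xy creates no new vertex set lying on a cycle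
   (Bondy-Chvatal). So let G* be the closure of G under such additions, w the
   clique number of G, S the set of vertices of G-degree at least n - w, and K a
   maximum clique of G*. If |K| > w, every vertex of S outside K would be joined
   to all of K, against maximality, so S lies in K, hence on a cycle. If |K| = w, we may take K to be a
   clique of G. The vertices of T = S \ K have degree exactly n - w in G*, and
   they are all joined to the set A of the vertices of K with a neighbour outside
   K; 2-connectedness gives |A| >= 2. Fix a0 in A. Unless
   |A| = |T| = n - w, which is the exceptional graph, the subgraph of G* induced
   on A \ a0 together with T (when |A| = n - w), or together with all vertices
   outside K (when |A| < n - w), satisfies the degree condition for all pairs
   of T, so its own closure makes (A \ a0) u T a clique. This yields a
   cycle into which K \ A and a0 can be inserted. *)

Set Implicit Arguments.
Unset Strict Implicit.
Unset Printing Implicit Defensive.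

(** * Vertex sets on a common cycle: Ore's crossing argument *)

Section Cyclability.
Variable V : finType.
Implicit Types (e : rel V) (S W K A T : {set V}).

Definition nbhd e x := [set y | e x y].

Definition on_cycle e S :=
  exists c : seq V, [/\ 2 < size c, ucycle e c & {subset S <= c}].

Definition clique e K := {in K &, forall x y, x != y -> e x y}.

Lemma on_cycleS e S S' : S \subset S' -> on_cycle e S' -> on_cycle e S.
Proof.
move=> /subsetP sSS' [c [c2 ec Sc]]; exists c; split=> // x /sSS'; exact: Sc.
Qed.

Lemma card_nbhdW e e' x : subrel e e' -> #|nbhd e x| <= #|nbhd e' x|.
Proof.
by move=> see'; apply/subset_leq_card/subsetP => y; rewrite !inE; apply: see'.
Qed.

(** Pigeonhole over the [size p] steps of the path: without a step from a vertex in [b] to a vertex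
    in [a], each step contributes at most one to the two counts. *)
Lemma crossing_or_count (a b : pred V) x p :
  (exists s1 v s2, [/\ p = s1 ++ v :: s2, b (last x s1) & a v]) \/
  count a p + count b (belast x p) <= size p.
Proof.
elim: p x => [|v p IHp] x /=; first by right.
case: (boolP (b x && a v)) => [/andP[bx av]|nab].
  by left; exists [::], v, p.
case: (IHp v) => [[s1 [u [s2 [-> bu au]]]]|le_p].
  by left; exists (v :: s1), u, s2.
by right; move: nab; case: (b x); case: (a v) => //= _; lia.
Qed.

(** Follow the path up to [last x s1], jump to its far end, come back along it to [v], and close by
    the chord to [x]. *)
Lemma cycle_crossing e x s1 v s2 : symmetric e ->
  path e x (s1 ++ v :: s2) -> e (last v s2) (last x s1) -> e x v ->
  cycle e (x :: s1 ++ rev (v :: s2)).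
Proof.
move=> sym_e; rewrite cat_path /= => /and3P[p1 _ p2] eyu exv.
rewrite rcons_cat cat_path p1 /= lastI rev_rcons /= sym_e eyu /=.
rewrite rcons_path rev_path.
have -> : path (fun z => e^~ z) v s2 by rewrite (eq_path (e' := e)).
have -> : last (last v s2) (rev (belast v s2)) = v.
  by case: (s2) => //= z s; rewrite rev_cons last_rcons.
by rewrite sym_e exv.
Qed.

(* Either the two ends have a common neighbour off the path, or the degree
   condition survives on the path itself and Ore's crossing chords exist. *)
Lemma path_on_cycle e W x p : symmetric e -> irreflexive e ->
    (forall u v, e u v -> u \in W) ->
    path e x p -> uniq (x :: p) -> 1 < size p ->
    #|W| <= #|nbhd e x| + #|nbhd e (last x p)| ->
  on_cycle e [set z in x :: p].
Proof.
move=> sym_e irr_e supp_e px up p1 degxy; set y := last x p in degxy.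
have [/existsP[z /and3P[zP exz eyz]]|nocommon] :=
  boolP [exists z, [&& z \notin x :: p, e x z & e y z]].
  exists (z :: x :: p); split; first by rewrite /=; lia.
    by rewrite /ucycle cons_uniq zP up /= rcons_path px sym_e exz eyz.
  by move=> t; rewrite inE => tP; rewrite inE tP orbT.
have [[s1 [v [s2 [def_p eyu exv]]]]|le_count] :=
  crossing_or_count (e x) (e y) x p.
  exists (x :: s1 ++ rev (v :: s2)); split.
  - by move: p1; rewrite def_p /= !size_cat size_rev.
  - rewrite /ucycle cycle_crossing //.
    + move: up; rewrite def_p /= !mem_cat !cat_uniq mem_rev rev_uniq.
      by rewrite has_rev.
    + by rewrite -def_p.
    + by move: eyu; rewrite /y def_p last_cat.
  - by move=> t; rewrite !inE def_p !mem_cat mem_rev.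
pose P := [set z in x :: p].
have PW : P \subset W.
  apply/subsetP => t; rewrite inE => tP.
  case: p px {up y degxy nocommon le_count P} p1 tP => // z p /= /andP[exz pz] _.
  rewrite inE => /predU1P[->|]; first exact: supp_e exz.
  elim: p x z exz pz => [|z' p IHp] x' z exz /=.
    by rewrite inE => _ /eqP->; apply: (supp_e z x'); rewrite sym_e.
  case/andP=> ezz' pz'; rewrite inE => /predU1P[->|]; first exact: supp_e ezz'.
  exact: IHp ezz' pz'.
have cardP : #|P| = (size p).+1 by rewrite cardsE (card_uniqP up).
have countE a : #|[set z | a z] :&: P| = count a (x :: p).
  rewrite -size_filter -(card_uniqP (filter_uniq a up)).
  by apply: eq_card => z; rewrite !inE mem_filter inE.
have cx : #|nbhd e x :&: P| = count (e x) p by rewrite countE /= irr_e.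
have cy : #|nbhd e y :&: P| = count (e y) (belast x p).
  by rewrite countE lastI -cats1 count_cat /= irr_e !addn0.
(* Without a common neighbour off the path, the two neighbourhoods are disjoint there. The degrees
   then sum to at most [size p] on the path plus [#|W| - (size p).+1] off it, one short of
   [#|W|]. *)
have out : #|nbhd e x :\: P| + #|nbhd e y :\: P| <= #|W :\: P|.
  have /eqP dis : (nbhd e x :\: P) :&: (nbhd e y :\: P) == set0.
    apply: contraNT nocommon => /set0Pn[z]; rewrite !inE.
    move=> /andP[/andP[zP exz] /andP[_ eyz]].
    by apply/existsP; exists z; rewrite inE zP exz.
  rewrite -cardsUI dis cards0 addn0.
  apply/subset_leq_card/subsetP => z; rewrite !inE -andb_orr => /andP[-> /=].
  by rewrite ![e _ z]sym_e => /orP[/supp_e|/supp_e].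
have := cardsID P (nbhd e x); have := cardsID P (nbhd e y).
have := cardsID P W; rewrite (setIidPr PW) cardP cx cy.
lia.
Qed.

(** * The Bondy-Chvatal closure *)

Definition add_edge e x y : rel V :=
  fun u v => [|| e u v, (u == x) && (v == y) | (u == y) && (v == x)].

(** A cycle that uses the new edge becomes, once this edge is removed, a path of [e] from one of
    [x], [y] to the other through the same vertices, and [path_on_cycle] applies. *)
Lemma add_edge_cycle e W x y S : symmetric e -> irreflexive e ->
    (forall u v, e u v -> u \in W) -> x != y ->
    #|W| <= #|nbhd e x| + #|nbhd e y| ->
  on_cycle (add_edge e x y) S -> on_cycle e S.
Proof.
move=> sym_e irr_e supp_e xy degxy [c [c2 /andP[cc uc] Sc]].
have [|/allPn[z zc nez]] := boolP (all (fun z => e z (next c z)) c).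
  by move=> /allP ec; exists c; rewrite /ucycle uc cycle_from_next.
have e1z := next_cycle cc zc.
have [i q def_c] := rot_to zc.
have sz : size (rot i c) = size c by rewrite size_rot.
rewrite -(next_rot i uc) def_c in e1z nez.
rewrite def_c in sz; rewrite -(rot_cycle i) def_c in cc.
rewrite -(rot_uniq i) def_c in uc.
have {}Sc : {subset S <= z :: q} by move=> t /Sc; rewrite -def_c mem_rot.
have {}c2 : 1 < size q by move: c2; rewrite -sz.
case: q {i def_c sz zc} => [|b [|a q]] // in e1z nez cc uc Sc c2 *.
rewrite /= eqxx in e1z nez.
have zb : (z == x) && (b == y) || (z == y) && (b == x).
  by move: e1z; rewrite /add_edge (negPf nez).
have degzb : #|W| <= #|nbhd e b| + #|nbhd e z|.
  by case/orP: zb => /andP[/eqP-> /eqP->] //; rewrite addnC.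
(* The new edge joins [z] to its successor [b], so every step leaving another vertex is already in
   [e]. The step from [b] to [a] is therefore read backwards below. *)
have e1E u v : u \notin [:: z; b] -> add_edge e x y u v = e u v.
  rewrite !inE negb_or /add_edge => /andP[/negPf uz /negPf ub].
  by case/orP: zb => /andP[/eqP<- /eqP<-]; rewrite uz ub /= orbF.
have /and3P[zq bq /= uq] := uc.
move: cc => /= /and3P[_ eba pq].
have eba' : e b a.
  rewrite sym_e -e1E; last first.
    rewrite !inE; move: zq bq; rewrite !inE !negb_or ![_ == a]eq_sym.
    by case/and3P=> _ -> _ /andP[-> _].
  move: eba; rewrite /add_edge sym_e.
  by rewrite [(a == x) && _]andbC [(a == y) && _]andbC [X in _ || X]orbC.
have pq' : path e a (rcons q z).
  have : all (fun u => u \notin [:: z; b]) (a :: q).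
    apply/allP=> u uq'; rewrite !inE negb_or; apply/andP; split.
      by apply: contraNneq zq => <-; rewrite inE uq' orbT.
    by apply: contraNneq bq => <-.
  elim: q a {eba eba' uq zq bq uc Sc c2 e1z nez} pq => [|u q IHq] a /= /andP[eau pu].
    by case/andP=> na _; rewrite -(e1E a) ?andbT.
  by case/andP=> na nq; rewrite -(e1E a) // eau IHq.
apply: (@on_cycleS _ _ [set t in b :: rcons (a :: q) z]).
  apply/subsetP => t /Sc; rewrite !inE mem_rcons !inE.
  by case: (t == z); rewrite ?orbT //= orbC.
apply: (path_on_cycle (W := W)) => //.
- by rewrite /= eba'.
- rewrite -rcons_cons rcons_uniq zq /= bq; exact: uq.
- by rewrite size_rcons.
- by rewrite last_rcons.
Qed.

(** Induction on the number of nonadjacent ordered pairs. The set [W] supporting the edges serves as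
    the order of the graph, so that induced subgraphs can be closed without changing the vertex
    type. *)
Lemma closure_exists e W : symmetric e -> irreflexive e ->
    (forall u v, e u v -> u \in W) ->
  exists e', [/\ symmetric e', irreflexive e', subrel e e',
    {in W &, forall x y, x != y -> #|W| <= #|nbhd e' x| + #|nbhd e' y| -> e' x y}
    & forall S, on_cycle e' S -> on_cycle e S].
Proof.
have [m] := ubnP #|[set u : V * V | ~~ e u.1 u.2]|.
elim: m e => // m IHm e lt_m sym_e irr_e supp_e.
have [/existsP[x /existsP[y /and5P[xW yW xy degxy nexy]]]|closed_e] := boolP
  [exists x, exists y, [&& x \in W, y \in W, x != y,
     #|W| <= #|nbhd e x| + #|nbhd e y| & ~~ e x y]]; last first.
  exists e; split=> // x y xW yW xy degxy; apply: contraNT closed_e => nexy.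
  by apply/existsP; exists x; apply/existsP; exists y; apply/and5P.
have [||||e' [sym_e' irr_e' see' cl_e' back]] := IHm (add_edge e x y).
- apply: leq_trans (lt_m : _ <= m); apply: proper_card; apply/properP; split.
    by apply/subsetP => u; rewrite !inE negb_or => /andP[].
  by exists (x, y); rewrite !inE /add_edge /= ?eqxx ?orbT.
- move=> u v; rewrite /add_edge sym_e; congr (_ || _); rewrite orbC.
  by rewrite [(v == x) && _]andbC [(v == y) && _]andbC.
- move=> u; rewrite /add_edge irr_e /= [(u == y) && _]andbC orbb.
  by apply: contraNF xy => /andP[/eqP<- /eqP<-].
- move=> u v /or3P[/supp_e //| |] /andP[/eqP-> _] //.
exists e'; split=> //.
  by move=> u v euv; apply: see'; rewrite /add_edge euv.
by move=> S /back; apply: add_edge_cycle degxy.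
Qed.

(** Two vertices suffice, as [ucycle] accepts an edge traversed back and forth; [join_clique_ucycle]
    relies on this degenerate case. *)
Lemma clique_ucycle e K : clique e K -> 1 < #|K| -> ucycle e (enum K).
Proof.
move=> clK K1; rewrite /ucycle enum_uniq andbT.
apply: cycle_from_next (enum_uniq _) _ => x xK.
have xK' : x \in K by rewrite -mem_enum.
have yK : next (enum K) x \in K by rewrite -mem_enum mem_next.
apply: clK => //.
have [i q def_c] := rot_to xK.
have := rot_uniq i (enum K).
rewrite -(next_rot i (enum_uniq _)) def_c enum_uniq /=.
have : size (rot i (enum K)) = #|K| by rewrite size_rot -cardE.
rewrite def_c; case: q {def_c} => [|y q] /= => [K1'|_].
  by rewrite -K1' in K1.
by rewrite eqxx inE negb_or => /andP[] /andP[].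
Qed.

(** * 2-connectedness and cycles through cliques *)

Definition avoid z e : rel V := fun x y => [&& e x y, x != z & y != z].

Definition biconnected e :=
  2 < #|V| /\ forall z x y, x != z -> y != z -> connect (avoid z e) x y.

Lemma biconnectedW e e' : subrel e e' -> biconnected e -> biconnected e'.
Proof.
move=> see' [V2 con]; split=> // z x y xz yz.
apply: connect_sub (con z x y xz yz) => u v /and3P[euv uz vz].
by apply: connect1; rewrite /avoid see' ?uz.
Qed.

Lemma third_vertex (x y : V) : 2 < #|V| -> exists z, z != x /\ z != y.
Proof.
move=> V2; have : 0 < #|~: [set x; y]|.
  by have := cardsC [set x; y]; have := cards2 x y; lia.
by case/card_gt0P=> z; rewrite !inE negb_or => /andP[]; exists z.
Qed.

Lemma biconnected_neighbor e x y : biconnected e -> y != x ->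
  exists2 z, z != x & e y z.
Proof.
move=> [V2 con] yx; have [z [zx zy]] := third_vertex x y V2.
have /connectP[[|u p] /= pu def_z] := con x y z yx zx.
  by rewrite def_z eqxx in zy.
by case/andP: pu => /and3P[eyu _ ux] _; exists u.
Qed.

(** A neighbour [z] of [y] other than [x] is linked to [x] by a path avoiding [y]; the edges [xy]
    and [yz] close it. *)
Lemma edge_on_cycle e x y : symmetric e -> irreflexive e -> biconnected e ->
  e x y -> on_cycle e [set x; y].
Proof.
move=> sym_e irr_e bi_e exy.
have xy : x != y by apply: contraTneq exy => ->; rewrite irr_e.
have [z zx eyz] : exists2 z, z != x & e y z.
  by apply: biconnected_neighbor; rewrite // eq_sym.
have zy : z != y by apply: contraTneq eyz => ->; rewrite irr_e.
have /connectP[p0 pz0 last0] := bi_e.2 y z x zy xy.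
case/shortenP: pz0 last0 => p pz up _ def_x {p0}.
have p_gt0 : 0 < size p by case: p def_x {pz up} => // xz; rewrite xz eqxx in zx.
have pe : path e z p by apply: sub_path pz => u v /and3P[].
have yp : y \notin z :: p.
  rewrite inE eq_sym negb_or zy /= {zy eyz zx up def_x p_gt0 pe}.
  elim: p z pz => //= u p IHp z /andP[/and3P[_ _ uy] pu].
  by rewrite inE eq_sym negb_or uy (IHp u).
exists (y :: z :: p); split; first by rewrite /= ltnS.
  by rewrite /ucycle cons_uniq yp up /= rcons_path eyz pe -def_x exy.
move=> t; rewrite !inE => /orP[]/eqP->; rewrite ?eqxx //.
by rewrite def_x -[(_ == z) || _]in_cons mem_last orbT.
Qed.

(** Three or more vertices of a clique form a cycle in any order; a smaller clique is contained in
    an edge. *)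
Lemma clique_on_cycle e K : symmetric e -> irreflexive e -> biconnected e ->
  clique e K -> on_cycle e K.
Proof.
move=> sym_e irr_e bi_e clK; have [K3|K2] := ltnP 2 #|K|.
  exists (enum K); rewrite -cardE; split=> //; last by move=> x; rewrite mem_enum.
  by apply: clique_ucycle; rewrite // ltnW.
have nb x : exists y, e x y.
  have [y [yx _]] := third_vertex x x bi_e.1; rewrite eq_sym in yx.
  by have [z _ exz] := biconnected_neighbor bi_e yx; exists z.
suff [x [y [exy sK]]] : exists x y, e x y /\ K \subset [set x; y].
  exact: on_cycleS sK (edge_on_cycle _ _ _ exy).
case: (set_0Vmem K) => [->|[x xK]].
  have /card_gt0P[x _] : 0 < #|V| by case: bi_e; lia.
  by have [y exy] := nb x; exists x, y; rewrite sub0set.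
case: (set_0Vmem (K :\ x)) => [K0|[y]].
  have [y exy] := nb x; exists x, y; split=> //.
  by rewrite -(setD1K xK) K0 setU0 subsetUl.
rewrite !inE => /andP[yx yK]; exists x, y; split; first by rewrite clK // eq_sym.
suff -> : [set x; y] = K by [].
apply/eqP; rewrite eqEcard cards2 eq_sym yx K2 andbT.
by apply/subsetP => z; rewrite !inE => /orP[]/eqP->.
Qed.

(** * Cycles through a clique and vertices outside it *)

Lemma clique_path e K x s : clique e K -> {subset x :: s <= K} ->
  uniq (x :: s) -> path e x s.
Proof.
move=> clK; elim: s x => //= y s IHs x sK /andP[xs us].
rewrite clK ?IHs // ?sK ?inE ?eqxx ?orbT //.
  by move=> z zs; apply: sK; rewrite inE zs orbT.
by apply: contraNneq xs => ->; rewrite inE eqxx.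
Qed.

Definition within W e : rel V := fun u v => [&& e u v, u \in W & v \in W].

Lemma nbhd_within W e x : x \in W -> nbhd (within W e) x = nbhd e x :&: W.
Proof. by move=> xW; apply/setP=> y; rewrite !inE /within xW. Qed.

(** By the degree condition, [T], and with it [A :|: T], becomes a clique in the closure of the
    subgraph induced on [W]. *)
Lemma join_clique_ucycle e A T W : symmetric e -> irreflexive e ->
    clique e A -> A != set0 -> T != set0 -> [disjoint A & T] ->
    {in T & A, forall x y, e x y} -> A :|: T \subset W ->
    {in T, forall x, #|W| <= 2 * #|nbhd e x :&: W|} ->
  exists c, [/\ ucycle e c, {subset A :|: T <= c} & {subset c <= W}].
Proof.
move=> sym_e irr_e clA A0 T0 dAT eTA QW degT.
have cardQ : #|A :|: T| = #|A| + #|T|.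
  by have := cardsUI A T; rewrite (disjoint_setI0 dAT) cards0 addn0.
move: A0 T0; rewrite -!card_gt0 => A0 T0.
have eQ e' : subrel (within W e) e' -> symmetric e' ->
    {in T &, forall x y, x != y -> e' x y} -> clique e' (A :|: T).
  move=> see' sym_e' clT x y xQ yQ xy.
  have [xW yW] := (subsetP QW x xQ, subsetP QW y yQ).
  case/setUP: xQ => xQ; case/setUP: yQ => yQ; try by apply: clT.
  - by apply: see'; rewrite /within xW yW clA.
  - by rewrite sym_e'; apply: see'; rewrite /within xW yW eTA.
  - by apply: see'; rewrite /within xW yW eTA.
(* With at most two vertices, [A] and [T] are singletons and the edge between them is the degenerate
   [ucycle]. *)
have [Q3|Q2] := ltnP 2 #|A :|: T|; last first.
  exists (enum (A :|: T)); split=> [|x|x]; last 2 first.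
  - by rewrite mem_enum.
  - by rewrite mem_enum; apply: (subsetP QW).
  apply: clique_ucycle; last by lia.
  apply: (eQ) => // [x y /and3P[]//|x y xT yT xy].
  have sT : [set x; y] \subset T by apply/subsetP => z /set2P[]->.
  by have := subset_leq_card sT; rewrite cards2 xy; lia.
have [|||e' [sym_e' _ see' cl_e' back]] := @closure_exists (within W e) W.
- by move=> x y; rewrite /within sym_e [(x \in W) && _]andbC.
- by move=> x; rewrite /within irr_e.
- by move=> u v /and3P[].
have [c [c2 /andP[cc uc] Qc]] : on_cycle (within W e) (A :|: T).
  apply: back; exists (enum (A :|: T)); rewrite -cardE; split=> //; last first.
    by move=> x; rewrite mem_enum.
  apply: clique_ucycle; last by lia.
  apply: eQ => // x y xT yT xy.
  have [xW yW] : x \in W /\ y \in W.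
    by split; apply: (subsetP QW); rewrite inE ?xT ?yT orbT.
  apply: cl_e' => //.
  have := card_nbhdW x see'; have := card_nbhdW y see'.
  have := degT _ xT; have := degT _ yT; rewrite !nbhd_within //; lia.
exists c; split=> // [|x xc]; last by have /and3P[] := next_cycle cc xc.
by rewrite /ucycle uc andbT; apply: sub_cycle cc => u v /and3P[].
Qed.

(* The cycle through [T] and [A :\ a0] inside [W] is opened after a vertex of
   [A :\ a0], and [K :\: A] followed by [a0] is inserted there; what it visits
   before returning to the two sets is skipped. *)
Lemma clique_detour e K A T W a0 : symmetric e -> irreflexive e ->
    clique e K -> A \subset K -> a0 \in A -> 1 < #|A| ->
    T != set0 -> [disjoint K & T] -> {in T & A, forall x y, e x y} ->
    (A :\ a0) :|: T \subset W -> W :&: K \subset A :\ a0 ->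
    {in T, forall x, #|W| <= 2 * #|nbhd e x :&: W|} ->
  on_cycle e (K :|: T).
Proof.
move=> sym_e irr_e clK sAK a0A A1 T0 dKT eTA QW WK degT.
have sA'K : A :\ a0 \subset K by apply: subset_trans sAK; apply: subD1set.
have a0K := subsetP sAK _ a0A.
have A'0 : A :\ a0 != set0.
  by rewrite -card_gt0; move: A1; rewrite (cardsD1 a0 A) a0A.
have [c [/andP[cc uc] Qc cW]] : exists c,
    [/\ ucycle e c, {subset A :\ a0 :|: T <= c} & {subset c <= W}].
  apply: join_clique_ucycle => //.
  - by move=> x y /(subsetP sA'K) xK /(subsetP sA'K); apply: clK.
  - by apply: disjointWl dKT.
  - by move=> x y xT /setD1P[_]; apply: eTA.
have [a1 a1A'] := set0Pn _ A'0; have [x0 x0T] := set0Pn _ T0.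
have a1K := subsetP sA'K _ a1A'.
have a1c : a1 \in c by apply: Qc; rewrite inE a1A'.
have [i p def_c] := rot_to a1c.
have {}Qc : {subset A :\ a0 :|: T <= a1 :: p}.
  by move=> x /Qc; rewrite -def_c mem_rot.
have {}cW : {subset a1 :: p <= W} by move=> x; rewrite -def_c mem_rot; apply: cW.
rewrite -(rot_cycle i) def_c in cc; rewrite -(rot_uniq i) def_c in uc.
have hasp : has (mem (A :\ a0 :|: T)) p.
  apply/hasP; exists x0; last by rewrite /= inE x0T orbT.
  have := Qc x0; rewrite !inE x0T orbT => /(_ isT)/predU1P[x0a1|//].
  by have := disjointFr dKT a1K; rewrite -x0a1 x0T.
(* [x] is the first vertex after [a1] in [A :\ a0 :|: T], so dropping [p1] loses nothing
   required. *)
case: (split_find hasp) cc uc Qc cW => x p1 p2 /= xQ nop1.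
rewrite rcons_cat cat_path rcons_path last_rcons => /andP[_ p2e].
rewrite cat_uniq rcons_uniq mem_cat mem_rcons negb_or inE negb_or.
case/andP=> /andP[/andP[a1x _] a1p2] /and3P[_ disj up2] Qc cW.
have xp2 : x \notin p2.
  by apply: contra disj => xp2; apply/hasP; exists x; rewrite // mem_rcons mem_head.
have xpW t : t \in x :: p2 -> t \in W.
  move=> txp; apply: cW; rewrite inE mem_cat mem_rcons.
  by move: txp; rewrite !inE => /orP[->|->]; rewrite ?orbT.
(* Hence the rest of the cycle avoids [K :\: A] and [a0], the vertices to be inserted. *)
have xpK t : t \in x :: p2 -> t \in K -> t \in A :\ a0.
  by move=> /xpW tW tK; apply: (subsetP WK); rewrite inE tW.
have dropQ t : t \in A :\ a0 :|: T -> t \in a1 :: x :: p2.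
  move=> tQ; have := Qc t tQ; rewrite !inE mem_cat mem_rcons inE.
  case/or3P=> [->//|/orP[->|tp1]|->]; rewrite ?orbT //.
  by case/negP: nop1; apply/hasP; exists t.
have ea0x : e a0 x.
  case/setUP: xQ => [/setD1P[xa0 xA]|xT]; last by rewrite sym_e eTA.
  by rewrite clK ?(subsetP sAK) // eq_sym.
exists (a1 :: (enum (K :\: A) ++ [:: a0]) ++ x :: p2); split.
- by rewrite /= !size_cat /= addn1 addSn addnS.
- have a1a0 : a1 != a0 by case/setD1P: a1A'.
  have uB : uniq (a1 :: (enum (K :\: A) ++ [:: a0])).
    rewrite /= cat_uniq enum_uniq /= mem_cat !mem_enum !inE (negPf a1a0).
    by case/setD1P: a1A' => _ ->; rewrite a0A.
  have sB : {subset a1 :: (enum (K :\: A) ++ [:: a0]) <= K}.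
    move=> t; rewrite inE mem_cat mem_enum !inE => /or3P[/eqP->//|/andP[]//|/eqP->//].
  rewrite /ucycle /= rcons_cat cat_path (clique_path clK) //= last_cat /= ea0x p2e.
  have -> /= : a1 \notin (enum (K :\: A) ++ [:: a0]) ++ x :: p2.
    by rewrite mem_cat inE !negb_or a1x a1p2 !andbT; case/andP: uB.
  move: uB; rewrite cons_uniq => /andP[_ uB].
  rewrite cat_uniq uB cons_uniq xp2 up2 !andbT.
  apply/hasPn => t /xpK txpK; rewrite mem_cat mem_enum !inE; apply/negP.
  case/orP=> [/andP[tA tK]|/eqP def_t].
    by have /setD1P[_] := txpK tK; apply/negP.
  by have := txpK; rewrite def_t !inE eqxx => /(_ a0K).
- move=> t tKT; rewrite inE mem_cat mem_cat mem_enum.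
  have [/dropQ|] := boolP (t \in A :\ a0 :|: T).
    by rewrite inE => /orP[]->; rewrite ?orbT.
  move: tKT; rewrite !inE.
  by case: (t == a0); case: (t \in A); case: (t \in K); case: (t \in T);
    rewrite /= ?orbT.
Qed.

(** * Maximum cliques and the case analysis *)

Lemma cliqueP e K :
  reflect (clique e K) [forall x in K, forall y in K, (x != y) ==> e x y].
Proof.
apply: (iffP forall_inP) => [clK x y xK yK xy|clK x xK].
  by have /forall_inP/(_ y yK)/implyP := clK x xK; apply.
by apply/forall_inP => y yK; apply/implyP; apply: clK.
Qed.

Definition max_clique e K := clique e K /\ forall X, clique e X -> #|X| <= #|K|.

Lemma max_clique_exists e : exists K, max_clique e K.
Proof.
pose cl K := [forall x in K, forall y in K, (x != y) ==> e x y].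
have cl0 : cl set0 by apply/cliqueP => x y; rewrite inE.
have [K /cliqueP clK maxK] := arg_maxnP (fun X : {set V} => #|X|) cl0.
by exists K; split=> // X /cliqueP/maxK.
Qed.

Lemma max_clique_nonadj e K x : symmetric e -> max_clique e K -> x \notin K ->
  exists2 y, y \in K & ~~ e x y.
Proof.
move=> sym_e [clK maxK] xK; apply/exists_inP; apply: contraT.
rewrite negb_exists_in => /forall_inP exK.
have {}exK y : y \in K -> e x y by move=> /exK; rewrite negbK.
have := maxK (x |: K); rewrite cardsU1 xK ltnn; apply.
move=> u v; rewrite !inE => /predU1P[->|uK] /predU1P[->|vK] uv.
- by rewrite eqxx in uv.
- exact: exK.
- by rewrite sym_e exK.
- exact: clK.
Qed.

Lemma clique_degree e K y : clique e K -> y \in K -> #|K| <= #|nbhd e y|.+1.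
Proof.
move=> clK yK; rewrite (cardsD1 y) yK ltnS; apply/subset_leq_card/subsetP => z.
by rewrite !inE => /andP[zy zK]; rewrite clK // eq_sym.
Qed.

(** The outside neighbour [z] makes up for [y], which is not its own neighbour. *)
Lemma clique_degree_out e K y z : clique e K -> y \in K -> z \notin K -> e y z ->
  #|K| <= #|nbhd e y|.
Proof.
move=> clK yK zK eyz; have := cardsU1 z (K :\ y).
rewrite !inE (negPf zK) andbF (cardsD1 y K) yK /= => <-.
apply/subset_leq_card/subsetP => u.
by rewrite !inE => /predU1P[->//|/andP[uy uK]]; rewrite clK // eq_sym.
Qed.

(** All edges leaving [K] start in [A]; if [A] were contained in a single vertex [z], a path
    avoiding [z] could never leave [K] to reach [x]. *)
Lemma biconnected_cut e A K x : biconnected e -> x \notin K -> A \proper K ->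
  {in K & ~: K, forall u v, e u v -> u \in A} -> 1 < #|A|.
Proof.
move=> bi_e xK /properP[sAK [b bK bA]] attA; rewrite ltnNge; apply/negP => A1.
have [z [zx zb sAz]] : exists z, [/\ z != x, z != b & A \subset [set z]].
  case: (set_0Vmem A) => [->|[z zA]].
    have [z [zx zb]] := third_vertex x b bi_e.1.
    by exists z; rewrite sub0set.
  exists z; split.
  - by apply: contraNneq xK => <-; apply: (subsetP sAK).
  - by apply: contraNneq bA => <-.
  - by rewrite (eqP (_ : [set z] == A)) // eqEcard sub1set zA cards1.
have /connectP[p pb def_x] : connect (avoid z e) b x.
  by apply: bi_e.2; rewrite eq_sym.
case/negP: xK; rewrite def_x {def_x zb bA}.
elim: p b bK pb => //= u p IHp b bK /andP[/and3P[ebu bz _]]; apply: IHp.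
apply: contraNT bz => uK; rewrite -in_set1; apply: (subsetP sAz).
by apply: attA ebu => //; rewrite inE.
Qed.

(** The second alternative is the exceptional graph seen from inside: [A] is the first factor of the
    join, [K :\: A] the other complete part and [~: K] the edgeless part. *)
Lemma high_degree_on_cycle e K : symmetric e -> irreflexive e -> biconnected e ->
    max_clique e K ->
  let k := #|V| - #|K| in
  on_cycle e [set x | k <= #|nbhd e x|] \/
  exists A, [/\ A \subset K, #|A| = k, 1 < k < #|K| &
    {in ~: K, forall x, nbhd e x = A}].
Proof.
move=> sym_e irr_e bi_e [clK maxK] k; set S := [set x | _].
have [|e' [sym_e' irr_e' see' cl_e' back]] :=
  @closure_exists e [set: V] sym_e irr_e; first by [].
rewrite cardsT in cl_e'.
have {}cl_e' x y : x != y -> #|V| <= #|nbhd e' x| + #|nbhd e' y| -> e' x y.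
  by apply: cl_e'; rewrite inE.
have bi_e' : biconnected e' by apply: biconnectedW bi_e.
have cardK : #|K| + k = #|V| by rewrite /k subnKC ?max_card.
have clK' : clique e' K by move=> x y xK yK xy; apply/see'/clK.
have degS x : x \in S -> k <= #|nbhd e' x|.
  by rewrite inE => /leq_trans; apply; apply: card_nbhdW.
(* Some [y] in [K'] is not adjacent to [x]; its degree is at least [#|K'| - 1], and closedness keeps
   the sum of the two degrees below [#|V|]. *)
have nonadj K' x : max_clique e' K' -> x \notin K' ->
    #|nbhd e' x| + #|K'| <= #|V|.
  move=> mK' xK'; have [y yK' nexy] := max_clique_nonadj sym_e' mK' xK'.
  rewrite leqNgt; apply: contra nexy => lt_deg; apply: cl_e'.
    by apply: contraNneq xK' => ->.
  by have := clique_degree mK'.1 yK'; move: lt_deg; clear; lia.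
have [Ks mKs] := max_clique_exists e'.
have [ltK|leK] := ltnP #|K| #|Ks|.
  left; apply/back/(on_cycleS _ (clique_on_cycle sym_e' irr_e' bi_e' mKs.1)).
  apply/subsetP => x /degS kx; apply: contraT => /(nonadj _ _ mKs).
  by move: kx ltK cardK; clear; lia.
have {Ks mKs leK} mK' : max_clique e' K.
  by split=> // X /mKs.2 leX; apply: leq_trans leK.
have [T0|[x0 x0T]] := set_0Vmem (S :\: K).
  left; apply/back/(on_cycleS _ (clique_on_cycle sym_e' irr_e' bi_e' clK')).
  by rewrite -setD_eq0 T0.
set T := S :\: K in x0T.
have TK x : x \in T -> x \notin K by case/setDP.
have degT x : x \in T -> #|nbhd e' x| = k.
  case/setDP=> /degS kx /(nonadj _ _ mK'); move: kx cardK; clear; lia.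
pose A := [set y in K | [exists z in ~: K, e' y z]].
have sAK : A \subset K by apply/subsetP => y; rewrite inE => /andP[].
have attA : {in K & ~: K, forall u v, e' u v -> u \in A}.
  by move=> u v uK vK euv; rewrite inE uK; apply/exists_inP; exists v.
(* A vertex of [A] has degree at least [#|K|] and one of [T] has degree [k], so closedness makes
   them adjacent. *)
have eTA : {in T & A, forall x y, e' x y}.
  move=> x y xT; rewrite inE => /andP[yK /exists_inP[z zK eyz]].
  apply: cl_e'; first by apply: contraNneq (TK x xT) => ->.
  rewrite inE in zK; rewrite (degT x xT) addnC -cardK leq_add2r.
  exact: clique_degree_out eyz.
have x0K := TK x0 x0T.
have pAK : A \proper K.
  apply/properP; split=> //.
  have [b bK nebx] := max_clique_nonadj sym_e' mK' x0K.
  by exists b => //; apply: contra nebx; apply: eTA.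
have A1 : 1 < #|A| by apply: biconnected_cut x0K pAK attA.
have sAN x : x \in T -> A \subset nbhd e' x.
  by move=> xT; apply/subsetP => y yA; rewrite inE eTA.
have Ak : #|A| <= k by rewrite -(degT x0 x0T) subset_leq_card // sAN.
have NA x y : x \in T -> e' x y -> y \in K -> y \in A.
  by move=> xT exy yK; apply: (attA y x); rewrite ?inE ?TK // sym_e'.
have [a0 a0A] : exists a0, a0 \in A by apply/card_gt0P/ltnW.
have cardA' : (#|A :\ a0|).+1 = #|A| by rewrite (cardsD1 a0 A) a0A.
have dKT : [disjoint K & T].
  by rewrite -setI_eq0; apply/eqP/setP=> x; rewrite !inE; case: (x \in K).
have T0 : T != set0 by apply/set0Pn; exists x0.
have detour W : (A :\ a0) :|: T \subset W -> W :&: K \subset A :\ a0 ->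
    {in T, forall x, #|W| <= 2 * #|nbhd e' x :&: W|} -> on_cycle e S.
  move=> QW WK degW; apply/back/(on_cycleS (S' := K :|: T)).
    by apply/subsetP => x xS; rewrite in_setU in_setD xS andbT orbN.
  exact: (@clique_detour _ K A T W a0).
(* Here each vertex of [T] loses only the neighbour [a0], keeping [k - 1], while
   [#|W| <= (#|A| - 1) + k <= 2 * (k - 1)]. *)
have [lt_Ak|le_kA] := ltnP #|A| k.
  left; apply: (detour (A :\ a0 :|: ~: K)).
  - by apply: setUS; apply/subsetP => x /TK; rewrite inE.
  - by rewrite setIUl [~: K :&: K]setIC setICr setU0 subsetIl.
  move=> x xT.
  have -> : nbhd e' x :&: (A :\ a0 :|: ~: K) = nbhd e' x :\ a0.
    apply/setP=> y; rewrite !(in_setI, in_setU, in_setD1, in_setC) [y \in nbhd _ _]inE.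
    rewrite andbC; case: (boolP (e' x y)) => exy; rewrite ?andbF ?andbT //.
    have := subsetP sAK a0 a0A; have := NA x y xT exy.
    case: (y =P a0) => [-> _ ->|_ + _]; first by [].
    by case: (y \in K) => [->|_]; rewrite ?orbT.
  have := cardsD1 a0 (nbhd e' x); rewrite (subsetP (sAN x xT)) // degT //.
  have := (leq_card_setU (A :\ a0) (~: K)).1; have := cardsC K.
  by move: cardA' lt_Ak cardK; clear; lia.
have NE x : x \in T -> nbhd e' x = A.
  by move=> xT; apply/esym/eqP; rewrite eqEcard sAN // degT.
(* Now [A :\ a0] gives each vertex of [T] its [k - 1] neighbours in [W], and
   [#|W| <= (k - 1) + #|T| <= 2 * (k - 1)]. *)
have [lt_Tk|le_kT] := ltnP #|T| k.
  left; apply: (detour (A :\ a0 :|: T)) => // [|x xT].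
    by rewrite setIUl [T :&: K]setIC (disjoint_setI0 dKT) setU0 subsetIl.
  have sA' : A :\ a0 \subset nbhd e' x :&: (A :\ a0 :|: T).
    by rewrite NE // subsetI subD1set subsetUl.
  have := subset_leq_card sA'; have := (leq_card_setU (A :\ a0) T).1.
  by move: cardA' le_kA lt_Tk; clear; lia.
right; exists A; have eqAk : #|A| = k by apply/eqP; rewrite eqn_leq Ak.
split=> // [|x xK]; first by rewrite -eqAk A1 proper_card.
have /eqP eqT : T == ~: K.
  rewrite eqEcard; apply/andP; split; first by apply/subsetP => y /TK; rewrite inE.
  by have := cardsC K; move: cardK le_kT; clear; lia.
have xT : x \in T by rewrite eqT.
(* Back to the original graph: the neighbourhood of [x] in [e] lies in [A] and, as [x] is in [S],
   has at least [k = #|A|] elements. *)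
apply/eqP; rewrite eqEcard -{1}(NE x xT); apply/andP; split.
  by apply/subsetP => y; rewrite !inE; apply: see'.
by case/setDP: xT; rewrite inE eqAk.
Qed.
End Cyclability.

(** * Transfer to [sgraph] and the exceptional graph *)

Lemma k_connected_biconnected (G : sgraph) :
  k_connected 2 G -> biconnected (@adj G).
Proof.
case=> G2 con; split=> // z x y xz yz.
have memCz u : u != z -> u \in ~: [set z] by rewrite !inE.
have [|_ conz] := con [set z]; first by rewrite cards1.
have /connectP[p px def_y] := conz (Sub x (memCz x xz)) (Sub y (memCz y yz)).
rewrite -[y](SubK {u | u \in ~: [set z]} (memCz y yz)) def_y.
rewrite -[X in connect _ X _](SubK {u | u \in ~: [set z]} (memCz x xz)).
elim: p (Sub x _) px {def_y} => //= v p IHp u /andP[uv pv].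
apply: connect_trans (IHp v pv); apply: connect1.
have uz : val u \in ~: [set z] := valP u.
have vz : val v \in ~: [set z] := valP v.
by move: uz vz; rewrite !inE => uz vz; apply/and3P.
Qed.

Lemma clique_number_max (G : sgraph) :
  exists2 K, max_clique (@adj G) K & #|K| = clique_number G.
Proof.
have [K mK] := max_clique_exists (@adj G); exists K => //.
apply/eqP; rewrite eqn_leq; apply/andP; split.
  exact/leq_bigmax_cond/cliqueP/mK.1.
by apply/bigmax_leqP => X /cliqueP/mK.2.
Qed.

Lemma exceptional_isomorphic (G : sgraph) (n w : nat) (K A : {set G}) :
    #|G| = n -> #|K| = w -> clique (@adj G) K -> A \subset K -> #|A| = n - w ->
    {in ~: K, forall x, nbhd (@adj G) x = A} ->
  isomorphic G (join (complete (n - w))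
    (union (complete (2 * w - n)) (compl (complete (n - w))))).
Proof.
move=> cardG cardK clK sAK cardA nbhdE.
have cardB : #|K :\: A| = 2 * w - n.
  have := cardsC K; rewrite cardsD (setIidPr sAK) cardK cardA cardG.
  by have := subset_leq_card sAK; rewrite cardA cardK; lia.
have cardC : #|~: K| = n - w by have := cardsC K; lia.
set H := join _ _.
(* The map is built from the join to [G] by enumerating the three parts; its inverse is the required
   isomorphism. *)
pose g (u : H) : G := match u with
  | inl i => enum_val (cast_ord (esym cardA) i)
  | inr (inl i) => enum_val (cast_ord (esym cardB) i)
  | inr (inr i) => enum_val (cast_ord (esym cardC) i)
  end.
have gA i : g (inl i) \in A by apply: enum_valP.
have gB i : g (inr (inl i)) \in K :\: A by apply: enum_valP.
have gC i : g (inr (inr i)) \in ~: K by apply: enum_valP.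
have gAK i : g (inl i) \in K by apply: (subsetP sAK).
have gBK i : g (inr (inl i)) \in K by case/setDP: (gB i).
have gCK i : g (inr (inr i)) \notin K by rewrite -in_setC.
have gBA i : g (inr (inl i)) \notin A by case/setDP: (gB i).
have inj_g : injective g.
  move=> [i|[i|i]] [j|[j|j]] eq_g.
  - by congr inl; apply: cast_ord_inj (enum_val_inj eq_g).
  - by have := gBA j; rewrite -eq_g gA.
  - by have := gCK j; rewrite -eq_g gAK.
  - by have := gBA i; rewrite eq_g gA.
  - by congr (inr (inl _)); apply: cast_ord_inj (enum_val_inj eq_g).
  - by have := gCK j; rewrite -eq_g gBK.
  - by have := gCK i; rewrite eq_g gAK.
  - by have := gCK i; rewrite eq_g gBK.
  - by congr (inr (inr _)); apply: cast_ord_inj (enum_val_inj eq_g).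
have adjK x y : x \in K -> y \in K -> adj x y = (x != y).
  move=> xK yK; case: eqVneq => [->|/clK]; first exact: adj_irrefl.
  by move=> /(_ xK yK).
have adjC x y : x \in ~: K -> adj x y = (y \in A).
  by move=> xK; rewrite -(nbhdE x xK) inE.
have adj_g u v : adj (g u) (g v) = adj u v.
  case: u v => [i|[i|i]] [j|[j|j]].
  - by rewrite adjK // (inj_eq inj_g).
  - by rewrite adjK // (inj_eq inj_g).
  - by rewrite adj_sym adjC // gA.
  - by rewrite adjK // (inj_eq inj_g).
  - by rewrite adjK // (inj_eq inj_g).
  - by rewrite adj_sym adjC // (negPf (gBA i)).
  - by rewrite adjC // gA.
  - by rewrite adjC // (negPf (gBA j)).
  (* Adjacency in the complement of a complete graph unfolds to [b && ~~ b]. *)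
  - rewrite adjC //; transitivity false; last exact/esym/andbN.
    by apply: contraNF (gCK j) => /(subsetP sAK).
have cardH : #|G| <= #|H|.
  rewrite !card_sum !card_ord -cardB.
  have := cardsC K; have := cardsID A K; rewrite (setIidPr sAK) cardA cardC.
  by clear; lia.
have [f gK fK] := inj_card_bij inj_g cardH.
by exists f; [exists g | move=> x y; rewrite -adj_g !fK].
Qed.

Theorem theorem1p2 (G : sgraph) (n w : nat)
    (hn : #|G| = n) (hw : clique_number G = w)
    (hconn : k_connected 2 G)
    (hexc : ~ (n + 1 <= 2 * w /\ w <= n - 2 /\
               isomorphic G
                 (join (complete (n - w))
                       (union (complete (2 * w - n))
                              (compl (complete (n - w))))))) :
  exists c : seq G, is_cycle c /\ forall x : G, n - w <= degree x -> x \in c.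
Proof.
have [K mK cardK] := clique_number_max G; rewrite hw in cardK.
have := high_degree_on_cycle (@adj_sym G) (@adj_irrefl G)
  (k_connected_biconnected hconn) mK.
rewrite /= hn cardK => -[[c [c2 cc Sc]]|[A [sAK cardA /andP[k1 kw] nbhdE]]].
  exists c; split; first by rewrite /is_cycle c2; exact: cc.
  by move=> x degx; apply: Sc; rewrite inE.
(* With [k = n - w], the bound [k < w] gives [n + 1 <= 2 * w] and [1 < k] gives [w <= n - 2]. *)
case: hexc; split; first by lia.
split; first by lia.
exact: exceptional_isomorphic hn cardK mK.1 sAK cardA nbhdE.
Qed.
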